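(* Let $\psi:\mathbb{T}^2\to\mathbb{R}$ be a non-constant real eigenfunction of the Laplacian on the flat two-dimensional torus $\mathbb{T}^2$, and let $1\le p<\infty$. Then $$\int_{\{\psi>0\}}|\psi(x)|^p\,dx=\int_{\{\psi<0\}}|\psi(x)|^p\,dx.$$
   Context: $\mathbb{T}^2=\mathbb{R}^2/\mathbb{Z}^2$ is the standard flat torus and $dx$ is Lebesgue measure on it. A real eigenfunction is a smooth function $\psi:\mathbb{T}^2\to\mathbb{R}$, not identically zero, with $-\Delta\psi=\mu\psi$ for some real $\mu$; equivalently, for some integer $\lambda\ge 0$, $\psi$ is a real-valued linear combination of the exponentials $\exp(2\pi i(\nu_1x+\nu_2y))$ with $\nu\in\mathbb{Z}^2$, $\nu_1^2+\nu_2^2=\lambda$. *)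

(* Defs.v *)
From HB Require Import structures.
From mathcomp Require Import all_boot all_order all_algebra.
From mathcomp Require Import all_classical all_reals all_analysis.

Set Implicit Arguments.
Unset Strict Implicit.
Unset Printing Implicit Defensive.

Import Order.TTheory GRing.Theory Num.Theory.
Import numFieldNormedType.Exports.

Local Open Scope classical_set_scope.
Local Open Scope ring_scope.

(* A function on the torus R^2/Z^2 is encoded as a Z^2-periodic function on
   the plane. *)
Definition Z2_periodic (R : realType) (f : R * R -> R) : Prop :=
  periodic f (1, 0) /\ periodic f (0, 1).

Definition coord_dir (R : realType) (second : bool) : R * R :=
  if second then (0, 1) else (1, 0).

Fixpoint iter_partial (R : realType) (s : seq bool) (f : R * R -> R) :
    R * R -> R :=
  if s is b :: s' then fun x => 'D_(coord_dir R b) (iter_partial s' f) x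
  else f.

(* 'D_v is total (a default value is returned where the limit does not exist),
   so differentiability of every iterated partial has to be required. *)
Definition smooth (R : realType) (f : R * R -> R) : Prop :=
  forall s : seq bool,
    continuous (iter_partial s f) /\
    forall (b : bool) (x : R * R),
      derivable (iter_partial s f) x (coord_dir R b).

Definition laplacian (R : realType) (f : R * R -> R) (x : R * R) : R :=
  iter_partial [:: false; false] f x + iter_partial [:: true; true] f x.

Definition torus_eigenfunction (R : realType) (psi : R * R -> R) : Prop :=
  [/\ Z2_periodic psi,
      smooth psi,
      exists x, psi x != 0 &
      exists mu : R, forall x, - laplacian psi x = mu * psi x].

(* A fundamental domain of Z^2; Lebesgue measure on the torus is planar
   Lebesgue measure restricted to it. *)
Definition unit_square (R : realType) : set (R * R) :=
  `[0, 1[%classic `*` `[0, 1[%classic.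
Arguments unit_square R : clear implicits.

Definition lebesgue_measure2 (R : realType) :=
  (@lebesgue_measure R \x @lebesgue_measure R)%E.
Arguments lebesgue_measure2 R : clear implicits.

(* Main.v *)
Require Import Defs.
From HB Require Import structures.
From mathcomp Require Import all_boot all_order all_algebra.
From mathcomp Require Import all_classical all_reals all_analysis.
From mathcomp Require Import measurable_realfun ring lra zify.

Set Implicit Arguments.
Unset Strict Implicit.
Unset Printing Implicit Defensive.

Import Order.TTheory GRing.Theory Num.Theory.
Import numFieldNormedType.Exports.

Local Open Scope classical_set_scope.
Local Open Scope ring_scope.

(** The eigenfunction [psi] is anti-invariant under a translation of the torus:
there is [t] with [psi (z + t) = - psi z] for all [z].  Translation by [t]
preserves Lebesgue measure and exchanges the sets where [psi] is positive and
negative, so the two integrals agree.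

The translation is found arithmetically.  The frequencies [(n, m)] occurring in
[psi] satisfy [n ^ 2 + m ^ 2 = N] for one [N], positive because [psi] is not
constant.  Dividing [N] by [4] as often as possible shows that all these
frequencies have the form [2 ^ k * (n', m')] for a common [k], and that either
[n'] is odd for all of them, or [n' + m'] is odd for all of them
([sum_two_squares_odd]).  Translation by [(1, 0) / 2 ^ (k + 1)] in the first
case, and by [(1, 1) / 2 ^ (k + 1)] in the second, then changes the sign of
every exponential that occurs.

Since [psi] is only known to be a smooth solution of the eigenvalue equation,
the argument is carried out on Fourier coefficients.  Integrating by parts twice
in each variable shows that the coefficient of frequency [(n, m)] vanishes
unless [mu = 4 pi ^ 2 (n ^ 2 + m ^ 2)] ([eigenfunction_coef]).  Hence every
coefficient of [psi (z + t) + psi z] vanishes, and a continuous periodic function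
whose coefficients all vanish is zero ([fourier_coef_eq0]).  That uniqueness
theorem is reduced to one variable, where it follows from the concentration of
the powers of a trigonometric polynomial at a point
([orthogonal_to_waves_le0]).

The final integrals are those of the continuous functions
[max 0 (psi z) `^ p] and [max 0 (- psi z) `^ p], so only integrals of continuous
functions ever have to be translated. *)

(** * Means of continuous functions over a period *)

(** Integral over one period of a 1-periodic function. *)
Definition mean (R : realType) (f : R -> R) : R :=
  \int[@lebesgue_measure R]_(x in `[0, 1]) f x.

Lemma continuous_integrable_segment (R : realType) (f : R -> R) (a b : R) :
  continuous f -> (@lebesgue_measure R).-integrable `[a, b] (EFin \o f).
Proof.
move=> cf; apply: continuous_compact_integrable; first exact: segment_compact.
exact: continuous_subspaceT.
Qed.

Lemma EFin_mean (R : realType) (f : R -> R) : continuous f ->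
  ((mean f)%:E = \int[@lebesgue_measure R]_(x in `[0%R, 1%R]) (f x)%:E)%E.
Proof.
move=> cf; rewrite fineK//; apply: integrable_fin_num => //.
exact: continuous_integrable_segment.
Qed.

Lemma meanD (R : realType) (f g : R -> R) : continuous f -> continuous g ->
  mean (fun x => f x + g x) = mean f + mean g.
Proof.
by move=> cf cg; rewrite /mean RintegralD//; exact: continuous_integrable_segment.
Qed.

Lemma meanZ (R : realType) (c : R) (f : R -> R) : continuous f ->
  mean (fun x => c * f x) = c * mean f.
Proof.
by move=> cf; rewrite /mean RintegralZl//; exact: continuous_integrable_segment.
Qed.

Lemma mean_cst (R : realType) (c : R) : mean (fun=> c) = c.
Proof.
by rewrite /mean Rintegral_cst//= lebesgue_measure_itv/= lte_fin ltr01 oppr0 adde0 mulr1.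
Qed.

Lemma le_mean (R : realType) (f g : R -> R) : continuous f -> continuous g ->
  (forall x, 0 <= x <= 1 -> f x <= g x) -> mean f <= mean g.
Proof.
move=> cf cg fg; apply: le_Rintegral => //.
- exact: continuous_integrable_segment.
- exact: continuous_integrable_segment.
Qed.

Lemma eq_mean (R : realType) (f g : R -> R) : f =1 g -> mean f = mean g.
Proof. by move=> fg; apply: eq_Rintegral => x _; exact: fg. Qed.

(** The fundamental theorem of calculus; differentiability is needed on the closed
interval only. *)
Lemma mean_derive (R : realType) (F f : R -> R) :
  (forall x : R, 0 <= x <= 1 -> is_derive x 1 F (f x)) -> continuous f ->
  mean f = F 1 - F 0.
Proof.
move=> dF cf.
have cF x : 0 <= x <= 1 -> {for x, continuous F}.
  by move=> /dF dx; apply/differentiable_continuous/derivable1_diffP.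
rewrite /mean /Rintegral (@continuous_FTC2 _ _ F) //.
- exact: continuous_subspaceT.
- split.
  + by move=> x /[!in_itv]/= /andP[x0 x1]; have [] := dF x; rewrite ?ltW.
  + by apply: cvg_at_right_filter; apply: cF; rewrite lexx ler01.
  + by apply: cvg_at_left_filter; apply: cF; rewrite lexx ler01.
- move=> x /[!in_itv]/= /andP[x0 x1].
  by rewrite derive1E; apply: derive_val; apply: dF; rewrite !ltW.
Qed.

Lemma antiderivative (R : realType) (f : R -> R) (M : R) : continuous f ->
  exists F : R -> R, forall x : R, `|x| < M -> is_derive x 1 F (f x).
Proof.
move=> cf; exists (fun x => \int[@lebesgue_measure R]_(t in `[- M, x]) f t) => x.
rewrite ltr_norml => /andP[Mx xM].
have [d1 d2] := @continuous_FTC1_closed R f (- M) x M xM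
  (@continuous_integrable_segment R f _ _ cf) Mx (cf x).
by rewrite -d2 derive1E; by move/derivableP: d1.
Qed.

(** With an antiderivative [F] of [f], the function [F (x + 1) - F x] has derivative
[f (x + 1) - f x = 0], hence is constant. *)
Lemma mean_shift (R : realType) (f : R -> R) (a : R) : continuous f ->
  periodic f 1 -> mean (fun x => f (x + a)) = mean f.
Proof.
move=> cf pf; have [F dF] := @antiderivative R f (`|a| + 2) cf.
have dFs (x b : R) : `|x + b| < `|a| + 2 ->
    is_derive x 1 (fun y => F (y + b)) (f (x + b)).
  move=> /dF d; rewrite -[f _]mulr1 -[in X in _ * X](addr0 1).
  exact: (@is_derive1_comp _ F (fun y => y + b)).
have le1a (x : R) : `|x| <= 1 -> `|x + a| < `|a| + 2.
  by move=> x1; rewrite (le_lt_trans (ler_normD _ _))// addrC ltrD2l; lra.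
have -> : mean (fun x => f (x + a)) = F (1 + a) - F (0 + a).
  apply: (@mean_derive _ (fun x => F (x + a))).
    by move=> x /andP[x0 x1]; apply: dFs; apply: le1a; rewrite ger0_norm.
  move=> x; apply: continuous_comp; last exact: cf.
  by apply: cvgD; [exact: cvg_id|exact: cvg_cst].
have -> : mean f = F 1 - F 0.
  apply: mean_derive => // x /andP[x0 x1]; apply: dF; rewrite ger0_norm//.
  by have := normr_ge0 a; lra.
pose K (x : R) := F (x + 1) - F (x + 0).
have dK (x : R) : `|x| <= `|a| -> is_derive x 1 K 0.
  move=> xa; rewrite (_ : 0 = f (x + 1) - f (x + 0)); last by rewrite addr0 pf subrr.
  apply: is_deriveB; apply: dFs; last by rewrite addr0; lra.
  by rewrite (le_lt_trans (ler_normD _ _))// normr1; lra.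
have K_cst (x y : R) : x <= y -> `|x| <= `|a| -> `|y| <= `|a| -> K y = K x.
  move=> xy xa ya.
  have xya z : x <= z <= y -> `|z| <= `|a|.
    by move: xa ya; rewrite !ler_norml; lra.
  have [||c _] := @MVT_segment R K (fun=> 0) x y xy.
  - by move=> z /[!in_itv]/= /andP[xz zy]; apply/dK/xya; rewrite !ltW.
  - apply/continuous_in_subspaceT => z; rewrite inE/= in_itv/= => /xya/dK dz.
    exact/differentiable_continuous/derivable1_diffP.
  - by rewrite mul0r => /eqP; rewrite subr_eq0 => /eqP.
have -> : F (1 + a) - F (0 + a) = K a by rewrite /K addr0 (addrC 1) add0r.
have -> : F 1 - F 0 = K 0 by rewrite /K addr0 add0r.
by have [a0|a0] := leP 0 a; [apply: K_cst|apply/esym/K_cst];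
  rewrite ?normr0 // ltW.
Qed.

Lemma continuous_max0 (R : realType) (T : topologicalType) (f : T -> R) :
  continuous f -> continuous (fun x => Num.max 0 (f x)).
Proof.
move=> cf; under eq_fun do rewrite maxr_absE add0r.
move=> x; apply: cvgMl; apply: cvgD; first exact: cf.
by apply: cvg_norm; apply: cvgB; [exact: cvg_cst|exact: cf].
Qed.

(** * Uniqueness of Fourier coefficients in one variable *)

(** The real waves of frequency [n].  The phase [phi] covers sines as well as
cosines, and makes the family stable, up to scalars, under translation
and differentiation. *)
Definition wave (R : realType) (n : nat) (phi x : R) : R :=
  cos (pi *+ 2 * (n%:R * x) + phi).

Lemma wave_continuous (R : realType) (n : nat) (phi : R) :
  continuous (wave n phi).
Proof.
move=> x; apply: continuous_comp; last exact: continuous_cos.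
apply: cvgD; last exact: cvg_cst.
by apply: cvgMr; apply: cvgMr; exact: cvg_id.
Qed.

Lemma periodic_wave (R : realType) (n : nat) (phi : R) : periodic (wave n phi) 1.
Proof.
move=> x; rewrite /wave -[RHS](@periodicn _ _ _ _ (@cosD2pi R) n).
by congr cos; rewrite -[_ *+ n]mulr_natr; ring.
Qed.

Lemma cosM (R : realType) (a b : R) :
  cos a * cos b = 2^-1 * (cos (a + b) + cos (a - b)).
Proof. by rewrite cosB cosD; field. Qed.

(** The product of two waves is a combination of two waves.  Frequency zero is
separate because frequencies are natural numbers. *)
Lemma wave_succM (R : realType) (n : nat) (phi chi x : R) :
  wave n.+1 phi x * wave 1 chi x =
  2^-1 * (wave n.+2 (phi + chi) x + wave n (phi - chi) x).
Proof.
by rewrite /wave cosM; congr (_ * (cos _ + cos _)); ring.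
Qed.

Lemma wave0M (R : realType) (phi chi x : R) :
  wave 0 phi x * wave 1 chi x =
  2^-1 * (wave 1 (chi + phi) x + wave 1 (chi - phi) x).
Proof.
by rewrite mulrC /wave cosM; congr (_ * (cos _ + cos _)); ring.
Qed.

(** All the Fourier coefficients of [f] vanish. *)
Definition orthogonal_to_waves (R : realType) (f : R -> R) : Prop :=
  forall n phi, mean (fun x => f x * wave n phi x) = 0.

Lemma orthogonal_mulr_wave (R : realType) (f : R -> R) (c chi : R) :
  continuous f -> orthogonal_to_waves f ->
  orthogonal_to_waves (fun x => f x * (c + wave 1 chi x)).
Proof.
move=> cf of_ n phi.
have cfw m psi : continuous (fun x => f x * wave m psi x).
  by move=> x; apply: cvgM; [exact: cf|exact: wave_continuous].
have cfw2 a m psi : continuous (fun x => a * (f x * wave m psi x)).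
  by move=> x; apply: cvgMr; exact: cfw.
suff [m1 [psi1 [m2 [psi2 wE]]]] : exists m1 psi1 m2 psi2, forall x : R,
    wave n phi x * wave 1 chi x = 2^-1 * (wave m1 psi1 x + wave m2 psi2 x).
  rewrite (@eq_mean _ _ (fun x => c * (f x * wave n phi x) +
    (2^-1 * (f x * wave m1 psi1 x) + 2^-1 * (f x * wave m2 psi2 x)))).
    rewrite meanD//; last by move=> x; apply: cvgD; exact: cfw2.
    by rewrite meanD// !meanZ// !of_ !mulr0 !addr0.
  move=> x; have -> : f x * (c + wave 1 chi x) * wave n phi x =
    c * (f x * wave n phi x) + f x * (wave n phi x * wave 1 chi x) by ring.
  by rewrite wE; ring.
case: n => [|n].
- by exists 1%N, (chi + phi), 1%N, (chi - phi) => x; exact: wave0M.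
- by exists n.+2, (phi + chi), n, (phi - chi) => x; exact: wave_succM.
Qed.

Lemma continuous_gt_near (R : realType) (g : R -> R) (a c : R) :
  continuous g -> c < g a ->
  exists2 d, 0 < d < 2^-1 & forall x, `|x - a| <= d -> c < g x.
Proof.
move=> cg ca; have : \forall x \near a, c < g x.
  by apply: (@cvgr_gt _ _ _ _ g (g a) (cg a)).
move=> /nbhs_normP[e /= e0 eg]; exists (Num.min (e / 2) 4^-1).
  rewrite lt_min gt_min divr_gt0//= invr_gt0 ltr0n/=; apply/orP; right.
  by rewrite ltf_pV2 ?posrE// ltr_nat.
move=> x xd; apply: eg => /=; rewrite distrC (le_lt_trans xd)// gt_min.
by rewrite ltr_pdivrMr// ltr_pMr// ltr1n.
Qed.

Lemma mean_gt0 (R : realType) (g : R -> R) : continuous g ->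
  (forall x, 0 <= g x) -> 0 < g 2^-1 -> 0 < mean g.
Proof.
move=> cg g0 gpos.
have [d /andP[d0 d2] gd] := @continuous_gt_near R g 2^-1 (g 2^-1 / 2) cg
  ltac:(by rewrite ltr_pdivrMr// ltr_pMr// ltr1n).
set D := `[2^-1 - d, 2^-1 + d]%classic.
have DE x : D x -> `|x - 2^-1| <= d.
  by rewrite /D/= in_itv/= ler_norml; lra.
rewrite -lte_fin EFin_mean//; apply: (@lt_le_trans _ _
   (\int[@lebesgue_measure R]_(x in D) (g 2^-1 / 2)%:E)%E).
  rewrite /D integral_cst//= lebesgue_measure_itv/= lte_fin ifT; last lra.
  by rewrite -EFinB -EFinM lte_fin mulr_gt0 ?divr_gt0//; lra.
apply: (@le_trans _ _ (\int[@lebesgue_measure R]_(x in D) (g x)%:E)%E).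
  apply: ge0_le_integral; rewrite /D //.
  - by move=> x _; rewrite lee_fin divr_ge0// ltW.
  - by have /measurable_int := @continuous_integrable_segment R g (2^-1 - d) (2^-1 + d) cg.
  - by move=> x /DE/gd/ltW; rewrite lee_fin.
apply: ge0_subset_integral; rewrite /D //.
- by have /measurable_int := @continuous_integrable_segment R g 0 1 cg.
- by move=> x _; rewrite lee_fin.
- by move=> x; rewrite /D/= !in_itv/=; lra.
Qed.

(** The wave of frequency 1 peaking at the midpoint of the period. *)
Lemma wave1_kernel (R : realType) (x : R) :
  wave 1 (- pi) x = cos (pi *+ 2 * `|x - 2^-1|).
Proof.
have [h|h] := ger0P (x - 2^-1); rewrite /wave.
  by congr cos; field.
by rewrite -cosN; congr cos; field.
Qed.

(** If [f] were positive at the midpoint, it would be bounded below by some [c > 0]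
on the points at distance at most [d] from it.  Let [T] be the trigonometric
polynomial [1 - cos (2 pi d) + cos (2 pi (x - 1/2))], which is at least 1 at
these points and at most 1 in absolute value elsewhere in [[0, 1]].  All the
integrals of [f * T ^+ n] vanish, but by Bernoulli's inequality they grow at
least linearly in [n]. *)
Lemma orthogonal_to_waves_le0 (R : realType) (f : R -> R) :
  continuous f -> orthogonal_to_waves f -> f 2^-1 <= 0.
Proof.
move=> cf of_; rewrite leNgt; apply/negP => fpos.
have [d /andP[d0 d2] fd] := @continuous_gt_near R f 2^-1 (f 2^-1 / 2) cf
  ltac:(by rewrite ltr_pdivrMr// ltr_pMr// ltr1n).
set c := f 2^-1 / 2 in fd.
have c0 : 0 < c by rewrite divr_gt0.
pose T (x : R) := (1 - cos (pi *+ 2 * d)) + wave 1 (- pi) x.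
have cT : continuous T.
  by move=> x; apply: cvgD; [exact: cvg_cst|exact: wave_continuous].
have cfT n : continuous (fun x => f x * T x ^+ n).
  elim: n => [|n ih] x; first by under eq_fun do rewrite expr0 mulr1; exact: cf.
  under eq_fun do rewrite exprSr mulrA.
  by apply: cvgM; [exact: ih|exact: cT].
have ofT n : orthogonal_to_waves (fun x => f x * T x ^+ n).
  elim: n => [|n ih]; first by under eq_fun do rewrite expr0 mulr1.
  by under eq_fun do rewrite exprSr mulrA; exact: orthogonal_mulr_wave.
have mfT n : mean (fun x => f x * T x ^+ n) = 0.
  rewrite -(ofT n 0%N 0); apply: eq_mean => x.
  by rewrite /wave mul0r mulr0 add0r cos0 mulr1.
have pi0 : 0 < pi :> R := pi_gt0 R.
have Tle x : 0 <= x <= 1 -> `|x - 2^-1| <= d -> 1 <= T x.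
  move=> x01 xd; rewrite /T wave1_kernel.
  suff : cos (pi *+ 2 * d) <= cos (pi *+ 2 * `|x - 2^-1|) by lra.
  rewrite leNgt ltr_cos ?in_itv/=; last 2 first.
  - by apply/andP; split; nra.
  - by have := normr_ge0 (x - 2^-1) => ?; apply/andP; split; nra.
  - by rewrite -leNgt ler_pM2l//; lra.
have Tge x : 0 <= x <= 1 -> d < `|x - 2^-1| -> `|T x| <= 1.
  move=> x01 xd; rewrite /T wave1_kernel.
  have x2 : `|x - 2^-1| <= 2^-1 by rewrite ler_norml; lra.
  have := cos_geN1 (pi *+ 2 * `|x - 2^-1|).
  have := cos_le1 (pi *+ 2 * d).
  suff : cos (pi *+ 2 * `|x - 2^-1|) <= cos (pi *+ 2 * d).
    by rewrite ler_norml; lra.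
  rewrite leNgt ltr_cos ?in_itv/=; last 2 first.
  - by have := normr_ge0 (x - 2^-1) => ?; apply/andP; split; nra.
  - by apply/andP; split; nra.
  - by rewrite -leNgt ler_pM2l ?ltW//; lra.
have cnf : continuous (fun x => `|f x|) by move=> x; apply: cvg_norm; exact: cf.
have [m mI fm] : exists2 m, m \in `[0, 1]%R &
    forall t, t \in `[0, 1]%R -> `|f t| <= `|f m|.
  apply: (@EVT_max _ (fun x => `|f x|)) => //; exact: continuous_subspaceT.
(* [c * n%:R * g - `|f m|] bounds [f * T ^+ n] from below. *)
pose g (x : R) := Num.max 0 (T x - 1).
have cg : continuous g.
  apply: continuous_max0 => x.
  by apply: cvgB; [exact: cT|exact: cvg_cst].
have g_pos : 0 < mean g.
  apply: mean_gt0 => //; first by move=> x; rewrite /g le_max lexx.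
  rewrite /g lt_max; apply/orP; right.
  rewrite /T wave1_kernel subrr normr0 mulr0.
  have : cos (pi *+ 2 * d) < cos 0; last by lra.
  rewrite ltr_cos ?in_itv/=; last 2 first.
  - by rewrite lexx ltW.
  - by apply/andP; split; nra.
  - by nra.
have bound_n n : c * n%:R * mean g <= `|f m|.
  rewrite -subr_ge0 -oppr_le0 opprB -(mfT n).
  have -> : c * n%:R * mean g - `|f m| = mean (fun x => c * n%:R * g x + - `|f m|).
    rewrite meanD ?meanZ ?mean_cst//; first by move=> x; apply: cvgMr; exact: cg.
    exact: cst_continuous.
  apply: le_mean => //.
    by move=> x; apply: cvgD; [apply: cvgMr; exact: cg|exact: cvg_cst].
  move=> x x01; have xf := fm x; rewrite in_itv/= in xf; have {}xf := xf x01.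
  have [xd|xd] := leP `|x - 2^-1| d.
    have T1 := Tle _ x01 xd; have fx := fd _ xd.
    have gE : g x = T x - 1 by rewrite /g max_r// subr_ge0.
    have bern : 1 + n%:R * g x <= T x ^+ n.
      rewrite gE; elim: n {mfT ofT cfT} => [|n ih].
        by rewrite mul0r expr0 addr0.
      rewrite exprSr (le_trans _ (ler_wpM2r _ ih)) ?ler_wpM2r//; last lra.
      have : 0 <= n%:R * (T x - 1) ^+ 2 by rewrite mulr_ge0// sqr_ge0.
      by rewrite -natr1; nra.
    have : 0 <= n%:R * g x by rewrite mulr_ge0// gE subr_ge0.
    have := normr_ge0 (f m); nra.
  have T1 := Tge _ x01 xd.
  have -> : g x = 0 by rewrite /g max_l// subr_le0; move: T1; rewrite ler_norml; lra.
  rewrite mulr0 add0r lerNl; apply: (le_trans _ xf).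
  rewrite -normrN -mulNr (le_trans (ler_norm _))// normrM normrN normrX.
  by rewrite ler_piMr// exprn_ile1.
have cg0 : 0 < c * mean g by rewrite mulr_gt0.
have := bound_n (Num.bound (`|f m| / (c * mean g))).
rewrite leNgt => /negP; apply.
have := archi_boundP (divr_ge0 (normr_ge0 (f m)) (ltW cg0)).
by rewrite ltr_pdivrMr// mulrCA !mulrA.
Qed.

(** Translating [f] moves an arbitrary point to the midpoint of the period. *)
Lemma orthogonal_to_waves_eq0 (R : realType) (f : R -> R) :
  continuous f -> periodic f 1 -> orthogonal_to_waves f -> forall x, f x = 0.
Proof.
move=> cf pf of_ x; pose g (y : R) := f (y + (x - 2^-1)).
have cg : continuous g.
  move=> y; apply: continuous_comp; last exact: cf.
  by apply: cvgD; [exact: cvg_id|exact: cvg_cst].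
have og : orthogonal_to_waves g.
  move=> n phi; set a := x - 2^-1; set psi := phi - pi *+ 2 * (n%:R * a).
  rewrite -(of_ n psi) -(@mean_shift _ (fun y => f y * wave n psi y) a).
  - by apply: eq_mean => y; rewrite /g /wave; congr (_ * cos _); rewrite /psi; ring.
  - by move=> y; apply: cvgM; [exact: cf|exact: wave_continuous].
  - by move=> y; rewrite pf periodic_wave.
have -> : f x = g 2^-1 by rewrite /g addrC subrK.
apply/eqP; rewrite eq_le orthogonal_to_waves_le0//=.
rewrite -oppr_le0; apply: (@orthogonal_to_waves_le0 _ (fun y => - g y)).
  by move=> y; apply: cvgN; exact: cg.
move=> n phi; rewrite -[RHS](mulr0 (-1)) -(og n phi) -meanZ.
  by apply: eq_mean => y; rewrite mulN1r mulNr.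
by move=> y; apply: cvgM; [exact: cg|exact: wave_continuous].
Qed.

(** * Continuous functions on the plane *)

(** An open subset of the plane is the union of the rational boxes it contains. *)
Lemma open_measurable2 (R : realType) (U : set (R * R)) :
  open U -> measurable (U : set (measurableTypeR R * measurableTypeR R)).
Proof.
move=> oU; pose box (t : (rat * rat) * (rat * rat)) : set (R * R) :=
  `]ratr t.1.1, ratr t.1.2[%classic `*` `]ratr t.2.1, ratr t.2.2[%classic.
have -> : U = \bigcup_t (if `[< box t `<=` U >] then box t else set0).
  apply/seteqP; split=> [z Uz|z [t _]]; last by case: asboolP => // h; exact: h.
  have /nbhs_ballP[e /= e0 eU] : nbhs z U by exact: open_nbhs_nbhs.
  have itv_rat (x : R) : exists t : rat * rat,
      x - e < ratr t.1 < x /\ x < ratr t.2 < x + e.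
    have [a] : exists a, ratr a \in `]x - e, x[%R by apply: rat_in_itvoo; lra.
    have [b] : exists b, ratr b \in `]x, x + e[%R by apply: rat_in_itvoo; lra.
    by rewrite !in_itv/= => hb ha; exists (a, b).
  have [s [s1 s2]] := itv_rat z.1; have [t [t1 t2]] := itv_rat z.2.
  exists (s, t) => //; case: asboolP => [_|[]].
    by split; rewrite /= in_itv/=; lra.
  move=> w [/=]; rewrite !in_itv/= => ws wt; apply: eU.
  by split => /=; rewrite /ball/= ltr_norml; lra.
apply: countable_bigcupT_measurable => // t; case: asboolP => // _.
by apply: measurableX.
Qed.

Lemma continuous_measurable_fun2 (R : realType) (f : R * R -> R) :
  continuous f ->
  measurable_fun setT (f : measurableTypeR R * measurableTypeR R -> R).
Proof.
move=> /continuousP cf; apply: (measurability _ (RGenOpens.measurableE R)).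
move=> _ [_ [a [b ->] <-]]; rewrite setTI; apply: open_measurable2.
exact/cf/interval_open.
Qed.

Lemma continuous_pair (T U V : topologicalType) (f : T -> U) (g : T -> V) :
  continuous f -> continuous g -> continuous (fun x => (f x, g x)).
Proof.
move=> cf cg x.
by apply: (@cvg_pair _ _ _ _ (nbhs (f x)) (nbhs (g x))); [exact: cf|exact: cg].
Qed.

Lemma slice1_continuous (R : realType) (f : R * R -> R) (y : R) :
  continuous f -> continuous (fun x => f (x, y)).
Proof.
move=> cf x; apply: (@continuous_comp _ _ _ (fun t => (t, y))); last exact: cf.
by apply: continuous_pair; [by move=> ?; exact: cvg_id|exact: cst_continuous].
Qed.

Lemma slice2_continuous (R : realType) (f : R * R -> R) (x : R) :
  continuous f -> continuous (fun y => f (x, y)).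
Proof.
move=> cf y; apply: (@continuous_comp _ _ _ (fun t => (x, t))); last exact: cf.
by apply: continuous_pair; [exact: cst_continuous|by move=> ?; exact: cvg_id].
Qed.

Lemma continuous_bounded2 (R : realType) (f : R * R -> R) (a b c d : R) :
  continuous f -> exists M, forall x y,
    a <= x <= b -> c <= y <= d -> `|f (x, y)| <= M.
Proof.
move=> cf; have cK : compact (`[a, b] `*` `[c, d]).
  by apply: compact_setX; exact: segment_compact.
have /compact_bounded[M [_ Mf]] := continuous_compact (continuous_subspaceT cf) cK.
exists (M + 1) => x y xab ycd; apply: Mf; first by rewrite ltrDl.
by exists (x, y) => //; split; rewrite /= in_itv.
Qed.

Lemma mean_continuous (R : realType) (f : R * R -> R) :
  continuous f -> continuous (fun x => mean (fun y => f (x, y))).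
Proof.
move=> cf a; have [M fM] := @continuous_bounded2 _ _ (a - 1) (a + 1) 0 1 cf.
have aI : a \in `](a - 1), (a + 1)[%classic by rewrite inE/= in_itv/=; lra.
apply: (@continuity_under_integral R _ _ (@lebesgue_measure R)
  (fun x y => f (x, y)) `[0, 1]%classic _ (a - 1) (a + 1) _ _ (cst M)) => //.
- by move=> x _; apply: continuous_integrable_segment; exact: slice2_continuous.
- by apply: aeW => y _ x _; exact: slice1_continuous.
- by apply: continuous_integrable_segment; exact: cst_continuous.
- move=> x /=; rewrite in_itv/= => xI; apply: aeW => y; rewrite /= in_itv/= => yI.
  by apply: fM => //; lra.
Qed.

Lemma mean_continuous1 (R : realType) (f : R * R -> R) :
  continuous f -> continuous (fun y => mean (fun x => f (x, y))).
Proof.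
move=> cf; apply: (@mean_continuous _ (fun z => f (z.2, z.1))) => z.
by apply: continuous_comp; [exact: (@swap_continuous R R)|exact: cf].
Qed.

(** * Iterated integrals over the unit square *)

Lemma measurable_unit_square (R : realType) :
  measurable (unit_square R : set (measurableTypeR R * measurableTypeR R)).
Proof. by apply: measurableX. Qed.

Lemma integrable_unit_square (R : realType) (f : R * R -> R) : continuous f ->
  (@lebesgue_measure R \x @lebesgue_measure R)%E.-integrable
    (unit_square R) (EFin \o f).
Proof.
move=> cf; apply: measurable_bounded_integrable.
- exact: measurable_unit_square.
- rewrite /unit_square [X in (X < _)%E]product_measure1E//=.
  rewrite lebesgue_measure_itv/= lte_fin ltr01.
  by rewrite -EFinB -EFinM ltry.
- by apply: measurable_funTS; exact: continuous_measurable_fun2.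
- have [M fM] := @continuous_bounded2 _ _ 0 1 0 1 cf.
  exists M; split; first exact: num_real.
  move=> B MB [x y] [/=]; rewrite !in_itv/= => x01 y01.
  by apply/(le_trans _ (ltW MB))/fM; lra.
Qed.

Lemma integral_co01 (R : realType) (f : R -> R) : continuous f ->
  (\int[@lebesgue_measure R]_(x in `[0%R, 1%R[) (f x)%:E = (mean f)%:E)%E.
Proof.
move=> cf; rewrite integral_itv_bndo_bndc ?EFin_mean//.
apply/measurable_EFinP/measurable_funTS; exact: continuous_measurable_fun.
Qed.

Lemma integral_unit_square12 (R : realType) (f : R * R -> R) : continuous f ->
  (\int[lebesgue_measure2 R]_(z in unit_square R) (f z)%:E =
   (mean (fun x => mean (fun y => f (x, y))))%:E)%E.
Proof.
move=> cf; have msq := @measurable_unit_square R.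
rewrite /lebesgue_measure2 integral_mkcond -integral12_prod_meas1; last first.
  by apply/(integrable_mkcond _ msq); exact: integrable_unit_square.
rewrite -integral_co01; last exact: mean_continuous.
rewrite [RHS]integral_mkcond; apply: eq_integral => x _.
rewrite /fubini_F patchE; case: ifPn => x01.
  rewrite -integral_co01; last exact: slice2_continuous.
  rewrite [RHS]integral_mkcond; apply: eq_integral => y _.
  rewrite !patchE/=; congr (if _ then _ else _).
  by rewrite /unit_square in_setX x01.
rewrite integral0_eq// => y _; rewrite patchE ifF//.
by rewrite /unit_square in_setX (negbTE x01).
Qed.

Lemma integral_unit_square21 (R : realType) (f : R * R -> R) : continuous f ->
  (\int[lebesgue_measure2 R]_(z in unit_square R) (f z)%:E =
   (mean (fun y => mean (fun x => f (x, y))))%:E)%E.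
Proof.
move=> cf; have msq := @measurable_unit_square R.
rewrite /lebesgue_measure2 integral_mkcond -integral21_prod_meas1; last first.
  by apply/(integrable_mkcond _ msq); exact: integrable_unit_square.
rewrite -integral_co01; last exact: mean_continuous1.
rewrite [RHS]integral_mkcond; apply: eq_integral => x _.
rewrite /fubini_G patchE; case: ifPn => x01.
  rewrite -integral_co01; last exact: slice1_continuous.
  rewrite [RHS]integral_mkcond; apply: eq_integral => y _.
  rewrite !patchE/=; congr (if _ then _ else _).
  by rewrite /unit_square in_setX x01 andbT.
rewrite integral0_eq// => y _; rewrite patchE ifF//.
by rewrite /unit_square in_setX (negbTE x01) andbF.
Qed.

(** Integral over the torus of a doubly periodic function, as an iterated integral. *)
Definition mean2 (R : realType) (f : R * R -> R) : R :=
  mean (fun y => mean (fun x => f (x, y))).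

Lemma mean2_swap (R : realType) (f : R * R -> R) : continuous f ->
  mean2 f = mean (fun x => mean (fun y => f (x, y))).
Proof.
move=> cf; apply: EFin_inj.
by rewrite -integral_unit_square12// integral_unit_square21.
Qed.

(** * Fourier coefficients on the torus *)

Lemma eq_mean2 (R : realType) (f g : R * R -> R) : f =1 g -> mean2 f = mean2 g.
Proof. by move=> fg; apply: eq_mean => y; apply: eq_mean => x; exact: fg. Qed.

Lemma mean2D (R : realType) (f g : R * R -> R) : continuous f -> continuous g ->
  mean2 (fun z => f z + g z) = mean2 f + mean2 g.
Proof.
move=> cf cg; rewrite /mean2 -meanD; last 2 first.
- exact: mean_continuous1.
- exact: mean_continuous1.
by apply: eq_mean => y; rewrite meanD//; exact: slice1_continuous.
Qed.

Lemma mean2Z (R : realType) (c : R) (f : R * R -> R) : continuous f ->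
  mean2 (fun z => c * f z) = c * mean2 f.
Proof.
move=> cf; rewrite /mean2 -meanZ; last exact: mean_continuous1.
by apply: eq_mean => y; rewrite meanZ//; exact: slice1_continuous.
Qed.

Lemma translate_continuous (R : realType) (f : R * R -> R) (t : R * R) :
  continuous f -> continuous (fun z : R * R => f (z + t)).
Proof.
move=> cf z; apply: continuous_comp; last exact: cf.
by apply: cvgD; [exact: cvg_id|exact: cvg_cst].
Qed.

Lemma Z2_periodic1 (R : realType) (f : R * R -> R) (y : R) :
  Z2_periodic f -> periodic (fun x => f (x, y)) 1.
Proof. by move=> [pf _] x; rewrite -[RHS]pf; congr f; congr pair; rewrite /= addr0. Qed.

Lemma Z2_periodic2 (R : realType) (f : R * R -> R) (x : R) :
  Z2_periodic f -> periodic (fun y => f (x, y)) 1.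
Proof. by move=> [_ pf] y; rewrite -[RHS]pf; congr f; congr pair; rewrite /= addr0. Qed.

Lemma Z2_periodic_translate (R : realType) (f : R * R -> R) (t : R * R) :
  Z2_periodic f -> Z2_periodic (fun z => f (z + t)).
Proof. by move=> [pf1 pf2]; split=> z /=; rewrite addrAC ?pf1 ?pf2. Qed.

Lemma mean2_translate (R : realType) (f : R * R -> R) (t : R * R) :
  continuous f -> Z2_periodic f -> mean2 (fun z => f (z + t)) = mean2 f.
Proof.
case: t => a b cf pf.
transitivity (mean2 (fun z => f (z + (0, b)))).
  apply: eq_mean => y; rewrite -[RHS](mean_shift a).
  - by apply: eq_mean => x; congr f; congr pair; rewrite /= addr0.
  - exact: (@slice1_continuous _ _ y (@translate_continuous _ f (0, b) cf)).
  - exact: (@Z2_periodic1 _ _ y (@Z2_periodic_translate _ f (0, b) pf)).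
rewrite (mean2_swap cf) (mean2_swap (@translate_continuous _ f (0, b) cf)).
apply: eq_mean => x; rewrite -[RHS](mean_shift b).
- by apply: eq_mean => y; congr f; congr pair; rewrite /= addr0.
- exact: slice2_continuous.
- exact: Z2_periodic2.
Qed.

(** Products of waves in each variable. *)
Definition wave2 (R : realType) (n : nat) (phi : R) (m : nat) (chi : R)
  (z : R * R) : R := wave n phi z.1 * wave m chi z.2.

Lemma wave2_continuous (R : realType) (n : nat) (phi : R) (m : nat) (chi : R) :
  continuous (wave2 n phi m chi).
Proof.
move=> z; apply: cvgM; apply: continuous_comp.
- exact: cvg_fst.
- exact: wave_continuous.
- exact: cvg_snd.
- exact: wave_continuous.
Qed.

Lemma Z2_periodic_wave2 (R : realType) (n : nat) (phi : R) (m : nat) (chi : R) :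
  Z2_periodic (wave2 n phi m chi).
Proof.
by split=> z; rewrite /wave2 /= addr0 periodic_wave.
Qed.

(** The Fourier coefficients on the torus: [n] and [m] are the frequencies, [phi]
and [chi] the phases. *)
Definition fourier_coef (R : realType) (f : R * R -> R) n phi m chi : R :=
  mean2 (fun z => f z * wave2 n phi m chi z).

(** The one-variable uniqueness theorem is applied first in [y], to each Fourier
coefficient of the functions [f (_, y)], and then in [x], to each of these
functions. *)
Lemma fourier_coef_eq0 (R : realType) (f : R * R -> R) :
  continuous f -> Z2_periodic f ->
  (forall n phi m chi, fourier_coef f n phi m chi = 0) ->
  forall z, f z = 0.
Proof.
move=> cf pf cf0 [x y].
apply: (@orthogonal_to_waves_eq0 _ (fun x => f (x, y))).
- exact: slice1_continuous.
- exact: Z2_periodic1.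
move=> n phi; move: y.
have cfw : continuous (fun z : R * R => f z * wave n phi z.1).
  move=> z; apply: cvgM; first exact: cf.
  by apply: continuous_comp; [exact: cvg_fst|exact: wave_continuous].
apply: (@orthogonal_to_waves_eq0 _ (fun y => mean (fun x => f (x, y) * wave n phi x))).
- exact: (mean_continuous1 cfw).
- move=> y; apply: eq_mean => x'; congr (_ * _).
  exact: (@Z2_periodic2 _ f x' pf y).
- move=> m chi; rewrite -[RHS](cf0 n phi m chi); apply: eq_mean => y.
  rewrite mulrC -meanZ; last exact: (@slice1_continuous _ _ _ cfw).
  by apply: eq_mean => x'; rewrite /wave2 /=; ring.
Qed.

(** * Fourier coefficients of eigenfunctions *)

Lemma is_derive_wave (R : realType) (n : nat) (phi x : R) :
  is_derive x 1 (wave n phi) (pi *+ 2 * n%:R * wave n (phi + pi / 2) x).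
Proof.
rewrite /wave addrA cosDpihalf.
have d : is_derive x 1 (fun x : R => pi *+ 2 * (n%:R * x) + phi) (pi *+ 2 * n%:R).
  rewrite -[X in is_derive _ _ _ X]addr0; apply: is_deriveD.
  under eq_fun do rewrite mulrA.
  rewrite -[X in is_derive _ _ _ X]mulr1.
  exact: is_deriveZ.
rewrite mulrC; exact: (@is_derive1_comp _ cos _ x _ _ (is_derive_cos _) d).
Qed.

(** Integration by parts twice: the boundary terms cancel by periodicity. *)
Lemma mean_second_derivative_wave (R : realType) (f f1 f2 : R -> R) n (phi : R) :
  (forall x : R, is_derive x 1 f (f1 x)) ->
  (forall x : R, is_derive x 1 f1 (f2 x)) -> continuous f2 ->
  periodic f 1 -> periodic f1 1 ->
  mean (fun x => f2 x * wave n phi x) =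
  - (pi *+ 2 * n%:R) ^+ 2 * mean (fun x => f x * wave n phi x).
Proof.
move=> df df1 cf2 pf pf1; set k := pi *+ 2 * n%:R.
have cf : continuous f.
  by move=> x; apply/differentiable_continuous/derivable1_diffP; case: (df x).
have cfw (g : R -> R) : continuous g -> continuous (fun x => g x * wave n phi x).
  by move=> cg x; apply: cvgM; [exact: cg|exact: wave_continuous].
(* [F] has derivative [f2 * wave - f * wave''], the integrand. *)
pose F (x : R) := f1 x * wave n phi x - f x * (k * wave n (phi + pi / 2) x).
apply/eqP; rewrite mulNr -addr_eq0 -meanZ; last exact: cfw.
rewrite -meanD; last 2 first.
- exact: cfw.
- by move=> x; apply: cvgMr; exact: cfw.
rewrite (_ : mean _ = F 1 - F 0).
  have p0 (g : R -> R) : periodic g 1 -> g 1 = g 0.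
    by move=> pg; rewrite -{1}(add0r 1) pg.
  by rewrite /F (p0 f)// (p0 f1)// !(p0 _ (@periodic_wave R _ _)) subrr.
apply: mean_derive; last first.
  by move=> x; apply: cvgD; [|apply: cvgMr]; exact: cfw.
move=> x _; have dw1 := is_derive_wave n phi x.
have dw2 := is_derive_wave n (phi + pi / 2) x.
have e : wave n (phi + pi / 2 + pi / 2) x = - wave n phi x.
  by rewrite /wave -[RHS]cosDpi; congr cos; field.
rewrite e in dw2.
have dF := is_deriveB (is_deriveM (df1 x) dw1) (is_deriveM (df x) (is_deriveZ k dw2)).
apply: (is_derive_eq dF).
change (f1 x * (k * wave n (phi + pi / 2) x) + wave n phi x * f2 x
   - (f x * (k * (k * - wave n phi x)) + k * wave n (phi + pi / 2) x * f1 x) =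
   f2 x * wave n phi x + k ^+ 2 * (f x * wave n phi x)).
ring.
Qed.

Lemma is_derive_slice1 (R : realType) (f : R * R -> R) (x y : R) :
  derivable f (x, y) (coord_dir R false) ->
  is_derive x 1 (fun t => f (t, y)) ('D_(coord_dir R false) f (x, y)).
Proof.
have E : (fun h : R => h^-1 *: (f (h *: coord_dir R false + (x, y)) - f (x, y))) =
    (fun h : R => h^-1 *: ((fun t => f (t, y)) (h *: 1 + x) - f (x, y))).
  by apply/funext => h; rewrite /coord_dir; congr (_ *: (f (_, _) - _)) => /=;
    rewrite /scale_pair/= ?scaler0 ?add0r.
rewrite /derivable /derive E => d; exact: (DeriveDef d).
Qed.

Lemma is_derive_slice2 (R : realType) (f : R * R -> R) (x y : R) :
  derivable f (x, y) (coord_dir R true) ->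
  is_derive y 1 (fun t => f (x, t)) ('D_(coord_dir R true) f (x, y)).
Proof.
have E : (fun h : R => h^-1 *: (f (h *: coord_dir R true + (x, y)) - f (x, y))) =
    (fun h : R => h^-1 *: ((fun t => f (x, t)) (h *: 1 + y) - f (x, y))).
  by apply/funext => h; rewrite /coord_dir; congr (_ *: (f (_, _) - _)) => /=;
    rewrite ?scaler0 ?add0r.
rewrite /derivable /derive E => d; exact: (DeriveDef d).
Qed.

Lemma periodic_derive (R : realType) (f : R * R -> R) (v w : R * R) :
  periodic f w -> periodic (fun z => 'D_v f z) w.
Proof.
move=> pf z; rewrite /derive.
suff -> : (fun h : R => h^-1 *: ((f \o shift (z + w)) (h *: v) - f (z + w))) =
  (fun h : R => h^-1 *: ((f \o shift z) (h *: v) - f z)) by [].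
by apply/funext => h; rewrite /= addrA !pf.
Qed.

Lemma Z2_periodic_derive (R : realType) (f : R * R -> R) (v : R * R) :
  Z2_periodic f -> Z2_periodic (fun z => 'D_v f z).
Proof. by move=> [p1 p2]; split; exact: periodic_derive. Qed.

Lemma fourier_coef_second_derivative1 (R : realType) (f : R * R -> R) n phi m chi :
  smooth f -> Z2_periodic f ->
  fourier_coef (iter_partial [:: false; false] f) n phi m chi =
  - (pi *+ 2 * n%:R) ^+ 2 * fourier_coef f n phi m chi.
Proof.
move=> sf pf; have [cf df] := sf [::]; have [cf1 df1] := sf [:: false].
have [cf2 _] := sf [:: false; false].
rewrite /fourier_coef -mean2Z; last first.
  by move=> z; apply: cvgM; [exact: cf|exact: wave2_continuous].
apply: eq_mean => y.
have cfw (g : R * R -> R) : continuous g ->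
    continuous (fun x => g (x, y) * wave n phi x).
  move=> cg x; apply: cvgM; last exact: wave_continuous.
  exact: (@slice1_continuous _ g y cg).
transitivity (wave m chi y *
    mean (fun x => iter_partial [:: false; false] f (x, y) * wave n phi x)).
  by rewrite -meanZ; [apply: eq_mean => x; rewrite /wave2/=; ring|exact: cfw].
transitivity (wave m chi y * (- (pi *+ 2 * n%:R) ^+ 2 *
    mean (fun x => f (x, y) * wave n phi x))); last first.
  rewrite mulrA -meanZ; last exact: cfw.
  by apply: eq_mean => x; rewrite /wave2/=; ring.
congr (_ * _); apply: (@mean_second_derivative_wave _ (fun x => f (x, y))
  (fun x => iter_partial [:: false] f (x, y))).
- by move=> x; apply: is_derive_slice1; exact: df.
- by move=> x; apply: is_derive_slice1; exact: df1.
- exact: (@slice1_continuous _ _ y cf2).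
- exact: Z2_periodic1.
- by apply: (@Z2_periodic1 _ (iter_partial [:: false] f)); exact: Z2_periodic_derive.
Qed.

Lemma fourier_coef_second_derivative2 (R : realType) (f : R * R -> R) n phi m chi :
  smooth f -> Z2_periodic f ->
  fourier_coef (iter_partial [:: true; true] f) n phi m chi =
  - (pi *+ 2 * m%:R) ^+ 2 * fourier_coef f n phi m chi.
Proof.
move=> sf pf; have [cf df] := sf [::]; have [cf1 df1] := sf [:: true].
have [cf2 _] := sf [:: true; true].
have cfw2 (g : R * R -> R) : continuous g ->
    continuous (fun z => g z * wave2 n phi m chi z).
  by move=> cg z; apply: cvgM; [exact: cg|exact: wave2_continuous].
rewrite /fourier_coef -mean2Z; last exact: cfw2.
rewrite (mean2_swap (cfw2 _ cf2)) mean2_swap; last first.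
  by move=> z; apply: cvgMr; exact: (cfw2 _ cf).
apply: eq_mean => x.
have cfw (g : R * R -> R) : continuous g ->
    continuous (fun y => g (x, y) * wave m chi y).
  move=> cg y; apply: cvgM; last exact: wave_continuous.
  exact: (@slice2_continuous _ g x cg).
transitivity (wave n phi x *
    mean (fun y => iter_partial [:: true; true] f (x, y) * wave m chi y)).
  by rewrite -meanZ; [apply: eq_mean => y; rewrite /wave2/=; ring|exact: cfw].
transitivity (wave n phi x * (- (pi *+ 2 * m%:R) ^+ 2 *
    mean (fun y => f (x, y) * wave m chi y))); last first.
  rewrite mulrA -meanZ; last exact: cfw.
  by apply: eq_mean => y; rewrite /wave2/=; ring.
congr (_ * _); apply: (@mean_second_derivative_wave _ (fun y => f (x, y))
  (fun y => iter_partial [:: true] f (x, y))).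
- by move=> y; apply: is_derive_slice2; exact: df.
- by move=> y; apply: is_derive_slice2; exact: df1.
- exact: (@slice2_continuous _ _ x cf2).
- exact: Z2_periodic2.
- by apply: (@Z2_periodic2 _ (iter_partial [:: true] f)); exact: Z2_periodic_derive.
Qed.

(** A frequency occurs in an eigenfunction only if it matches the eigenvalue. *)
Lemma eigenfunction_coef (R : realType) (psi : R * R -> R) (mu : R) n phi m chi :
  smooth psi -> Z2_periodic psi ->
  (forall z, - laplacian psi z = mu * psi z) ->
  fourier_coef psi n phi m chi != 0 -> mu = (pi *+ 2) ^+ 2 * (n ^ 2 + m ^ 2)%:R.
Proof.
move=> sf pf eig c0; have [cf _] := sf [::].
have [cf1 _] := sf [:: false; false]; have [cf2 _] := sf [:: true; true].
have cfw2 (g : R * R -> R) : continuous g ->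
    continuous (fun z => g z * wave2 n phi m chi z).
  by move=> cg z; apply: cvgM; [exact: cg|exact: wave2_continuous].
have c12 : - mu * fourier_coef psi n phi m chi =
  fourier_coef (iter_partial [:: false; false] psi) n phi m chi +
  fourier_coef (iter_partial [:: true; true] psi) n phi m chi.
  rewrite /fourier_coef -mean2D; [|exact: cfw2..].
  rewrite -mean2Z; last exact: cfw2.
  by apply: eq_mean2 => z; rewrite -mulrDl mulrA mulNr -eig opprK.
have := etrans c12 (f_equal2 +%R (fourier_coef_second_derivative1 n phi m chi sf pf)
  (fourier_coef_second_derivative2 n phi m chi sf pf)).
rewrite -mulrDl => /(mulIf c0) h.
by rewrite -[mu]opprK h natrD !natrX; ring.
Qed.

(** * Anti-invariance of eigenfunctions under a translation *)

(** By descent on [N].  If 4 divides [N] then [n] and [m] are both even, and [N / 4]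
is treated by induction; if [N] is odd then so is [n + m]; if [N] is 2 modulo 4
then [n] is odd. *)
Lemma sum_two_squares_odd (N : nat) : (0 < N)%N ->
  exists k (b : bool), forall n m, (n ^ 2 + m ^ 2 = N)%N ->
  exists n' m', [/\ n = (2 ^ k * n')%N, m = (2 ^ k * m')%N & odd (n' + b * m')].
Proof.
elim/ltn_ind: N => N ih N0.
have halve n : exists (a : bool) p, n = (a + 2 * p)%N.
  by exists (odd n), n./2; rewrite mul2n odd_double_half.
have [N4|N4] := boolP (4 %| N)%N.
  have [M NM] := dvdnP N4; have [|//|k [b kb]] := ih M; first lia.
    by lia.
  exists k.+1, b => n m; have [a1 [p ->]] := halve n; have [a2 [q ->]] := halve m.
  move=> E; have [|n' [m' [pE qE o]]] := kb p q; first by case: a1 a2 E => [] []; nia.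
  exists n', m'; rewrite !expnS -!mulnA -pE -qE; split=> //.
    by case: a1 a2 E => [] []; nia.
  by case: a1 a2 E => [] []; nia.
exists 0%N; have [oN|eN] := boolP (odd N).
  exists true => n m E; exists n, m; split; rewrite ?expn0 ?mul1n//.
  by move: oN; rewrite -E !oddD !oddX.
exists false => n m E; exists n, m; split; rewrite ?expn0 ?mul1n// addn0.
apply: contraR N4 => en; have em : ~~ odd m.
  by move: eN; rewrite -E oddD !oddX/= (negbTE en).
apply/dvdnP; exists (n./2 ^ 2 + m./2 ^ 2)%N.
by have := even_halfK en; have := even_halfK em; rewrite -!mul2n; nia.
Qed.

Lemma wave_translate (R : realType) (k n : nat) (b : bool) (phi x : R) :
  wave (2 ^ k * n) phi (x - b%:R * 2^-1 ^+ k.+1) =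
  (-1) ^+ (b * n) * wave (2 ^ k * n) phi x.
Proof.
have h : (2 ^+ k : R) != 0 by rewrite expf_neq0// pnatr_eq0.
rewrite /wave; set y := (X in _ = _ * cos X).
set y' := (X in cos X = _).
have -> : y = y' + pi *+ (b * n).
  rewrite /y /y' mulrBr mulrBr [X in _ - X + _](_ : _ = pi *+ (b * n)); first by ring.
  rewrite -[RHS]mulr_natr natrM natrM natrX exprS exprVn.
  by field.
rewrite (alternatingn (@cosDpi R)) mulrA -exprD addnn -signr_odd odd_double expr0.
by rewrite mul1r.
Qed.

Lemma wave2_translate (R : realType) n phi m chi (z t : R * R) :
  wave2 n phi m chi (z - t) = wave2 n (phi - pi *+ 2 * (n%:R * t.1)) m
    (chi - pi *+ 2 * (m%:R * t.2)) z.
Proof.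
by rewrite /wave2 /wave; congr (cos _ * cos _); rewrite /=; ring.
Qed.

(** If translation by [t] multiplies by [s] every wave whose frequency matches the
eigenvalue, then it also multiplies the eigenfunction by [s]. *)
Lemma eigenfunction_translate (R : realType) (psi : R * R -> R) (mu s : R) (t : R * R) :
  smooth psi -> Z2_periodic psi ->
  (forall z, - laplacian psi z = mu * psi z) ->
  (forall n phi m chi z, mu = (pi *+ 2) ^+ 2 * (n ^ 2 + m ^ 2)%:R ->
    wave2 n phi m chi (z - t) = s * wave2 n phi m chi z) ->
  forall z, psi (z + t) = s * psi z.
Proof.
move=> sf pf eig hs z; apply/eqP; rewrite -subr_eq0 -mulNr; apply/eqP; move: z.
have [cf _] := sf [::].
have cft := @translate_continuous _ psi t cf.
have cW (g : R * R -> R) n phi m chi : continuous g ->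
    continuous (fun z => g z * wave2 n phi m chi z).
  by move=> cg z; apply: cvgM; [exact: cg|exact: wave2_continuous].
apply: (@fourier_coef_eq0 _ (fun z => psi (z + t) + - s * psi z)).
- by move=> z; apply: cvgD; [exact: cft|apply: cvgMr; exact: cf].
- have [pf1 pf2] := pf; have [pt1 pt2] := @Z2_periodic_translate _ psi t pf.
  split=> z; first by rewrite [psi (z + _)]pf1 [X in X + _]pt1.
  by rewrite [psi (z + _)]pf2 [X in X + _]pt2.
move=> n phi m chi.
have cPW := cW psi n phi m chi cf.
transitivity (fourier_coef (fun z => psi (z + t)) n phi m chi +
  - s * fourier_coef psi n phi m chi).
  rewrite /fourier_coef -mean2Z// -mean2D.
  - by apply: eq_mean2 => z; ring.
  - exact: cW.
  - by move=> z; apply: cvgMr; exact: cPW.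
have -> : fourier_coef (fun z => psi (z + t)) n phi m chi =
  mean2 (fun z => psi z * wave2 n phi m chi (z - t)).
  rewrite -[RHS](mean2_translate t).
  - by apply: eq_mean2 => z; rewrite addrK.
  - move=> z; apply: cvgM; first exact: cf.
    exact: (@translate_continuous _ _ (- t) (@wave2_continuous _ n phi m chi)).
  - have [pw1 pw2] := @Z2_periodic_translate _ _ (- t) (Z2_periodic_wave2 n phi m chi).
    have [pf1 pf2] := pf.
    by split=> z; [rewrite pf1 [X in _ * X]pw1|rewrite pf2 [X in _ * X]pw2].
have [E|/eqP NE] := pselect (mu = (pi *+ 2) ^+ 2 * (n ^ 2 + m ^ 2)%:R).
  rewrite mulNr (_ : mean2 _ = s * fourier_coef psi n phi m chi) ?subrr//.
  rewrite /fourier_coef -(mean2Z s cPW); apply: eq_mean2 => z; rewrite hs //; ring.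
have c0 phi' chi' : fourier_coef psi n phi' m chi' = 0.
  apply/eqP; apply: contraNT NE => /(eigenfunction_coef sf pf eig) E; exact/eqP.
rewrite c0 mulr0 addr0 -[RHS](c0 (phi - pi *+ 2 * (n%:R * t.1))
  (chi - pi *+ 2 * (m%:R * t.2))).
by apply: eq_mean2 => z; rewrite wave2_translate.
Qed.

Lemma eigenfunction_antiperiod (R : realType) (psi : R * R -> R) :
  torus_eigenfunction psi -> ~ (exists c : R, forall x, psi x = c) ->
  exists t, forall z, psi (z + t) = - psi z.
Proof.
move=> [pf sf _ [mu eig]] nc.
have pi0 : (pi *+ 2 : R) ^+ 2 != 0 by rewrite sqrf_eq0 mulrn_eq0/= gt_eqF// pi_gt0.
have [[N muN]|noN] := pselect (exists N : nat, mu = (pi *+ 2) ^+ 2 * N%:R); last first.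
  (* No frequency matches the eigenvalue: the condition on waves is vacuous. *)
  exists 0 => z; rewrite -mulN1r; apply: (eigenfunction_translate sf pf eig).
  by move=> n phi m chi w E; exfalso; apply: noN; exists (n ^ 2 + m ^ 2)%N.
have NE n m : mu = (pi *+ 2) ^+ 2 * (n ^ 2 + m ^ 2)%:R -> (n ^ 2 + m ^ 2 = N)%N.
  by rewrite muN => /(mulfI pi0)/eqP; rewrite eqr_nat => /eqP.
have [N0|N0] := posnP N.
  (* Only the frequency [(0, 0)] matches the eigenvalue: every translation
     leaves [psi] invariant. *)
  exfalso; apply: nc; exists (psi 0) => x.
  rewrite -[LHS]mul1r -[x]add0r -[RHS]mul1r mul1r.
  apply: (eigenfunction_translate sf pf eig) => n phi m chi z /NE.
  rewrite N0 => /eqP; rewrite addn_eq0 !expn_eq0 /= !andbT => /andP[/eqP-> /eqP->].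
  by rewrite wave2_translate !mul0r !mulr0 !subr0 mul1r.
have [k [b kb]] := sum_two_squares_odd N0.
exists (2^-1 ^+ k.+1, b%:R * 2^-1 ^+ k.+1) => z; rewrite -mulN1r.
apply: (eigenfunction_translate sf pf eig) => n phi m chi w /NE/kb.
move=> [n' [m' [-> -> o]]]; rewrite /wave2 /=.
rewrite -[X in wave _ phi (_ - X)]mul1r (wave_translate k n' true) (wave_translate k m' b).
rewrite mul1n mulrACA -exprD -signr_odd o expr1; ring.
Qed.

(** * Integrals of powers of the positive and negative parts *)

(** At 0, continuity follows from [x `^ p <= x] for [x] in [[0, 1]]. *)
Lemma powR_max0_continuous (R : realType) (p : R) : 1 <= p ->
  continuous (fun x : R => Num.max 0 x `^ p).
Proof.
move=> p1 a; have pn0 : p != 0 by rewrite gt_eqF// (lt_le_trans ltr01).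
have [a0|a0|->] := ltgtP a 0.
- rewrite /continuous_at max_l ?ltW// powR0//.
  apply: (@cvg_trans _ ((fun=> 0 : R) @ a)); last exact: (@cst_continuous R R 0 a).
  apply: near_eq_cvg; near=> x; rewrite max_l ?powR0// ltW//.
  by near: x; exact: lt_nbhsl.
- rewrite /continuous_at max_r ?ltW// /powR [a == 0]gt_eqF//.
  apply: (@cvg_trans _ (expR (p * ln x) @[x --> a])).
    apply: near_eq_cvg; near=> x.
    have x0 : 0 < x by near: x; exact: lt_nbhsr.
    by rewrite max_r ?ltW// gt_eqF.
  apply: (@cvg_comp _ _ _ (fun x : R => p * ln x) expR); last exact: continuous_expR.
  by apply: cvgMr; exact: continuous_ln.
- apply/cvgrPdist_le => /= e e0; near=> x.
  rewrite maxxx powR0// sub0r normrN ger0_norm ?powR_ge0//.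
  have xe : `|x| <= Num.min e 1.
    near: x; apply: (@nbhs0_le R R (Num.min e 1)).
    by rewrite lt_min e0 ltr01.
  move: xe; rewrite le_min => /andP[xe x1].
  have [x0|x0] := leP x 0; first by rewrite powR0// ltW.
  rewrite ger0_norm ?(ltW x0)// in xe x1.
  by rewrite (le_trans _ xe)// -[leRHS]powRr1 ?(ltW x0)// ger_powR// x0.
Unshelve. all: by end_near. Qed.

Lemma pos_part_powR_continuous (R : realType) (T : topologicalType) (f : T -> R)
    (p : R) : 1 <= p -> continuous f -> continuous (fun x => Num.max 0 (f x) `^ p).
Proof.
move=> p1 cf x.
apply: (@continuous_comp _ _ _ f (fun a : R => Num.max 0 a `^ p)); first exact: cf.
exact: powR_max0_continuous.
Qed.

Lemma integral_pos_part_powR (R : realType) (f : R * R -> R) (p : R) :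
  continuous f -> 1 <= p ->
  (\int[lebesgue_measure2 R]_(x in unit_square R `&` [set x | 0 < f x]%R)
     (`|f x| `^ p)%:E =
   (mean2 (fun x => Num.max 0 (f x) `^ p))%:E)%E.
Proof.
move=> cf p1; rewrite -integral_unit_square21; last exact: pos_part_powR_continuous.
rewrite integral_mkcondr; apply: eq_integral => z _; rewrite patchE.
have pn0 : p != 0 by rewrite gt_eqF// (lt_le_trans ltr01).
case: ifPn; rewrite ?inE ?notin_setE/=.
  by move=> f0; rewrite max_r ?ltW// gtr0_norm.
by move=> /negP; rewrite -leNgt => f0; rewrite max_l// powR0.
Qed.

Theorem corollary2p4 (R : realType) (psi : R * R -> R) (p : R)
    (hpsi : torus_eigenfunction psi)
    (hnc : ~ exists c : R, forall x, psi x = c)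
    (hp : 1 <= p) :
  (\int[lebesgue_measure2 R]_(x in unit_square R `&` [set x | 0 < psi x]%R)
     (`|psi x| `^ p)%:E =
   \int[lebesgue_measure2 R]_(x in unit_square R `&` [set x | psi x < 0]%R)
     (`|psi x| `^ p)%:E)%E.
Proof.
have [[pf1 pf2] sf _ _] := hpsi; have [cf _] := sf [::].
have [t tE] := eigenfunction_antiperiod hpsi hnc.
have cNf : continuous (fun z => - psi z) by move=> z; apply: cvgN; exact: cf.
rewrite (integral_pos_part_powR cf hp).
have cg := pos_part_powR_continuous hp cf.
have pg : Z2_periodic (fun z => Num.max 0 (psi z) `^ p).
  by split=> z /=; rewrite ?pf1 ?pf2.
have -> : mean2 (fun z => Num.max 0 (psi z) `^ p) =
    mean2 (fun z => Num.max 0 (- psi z) `^ p).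
  apply: etrans (esym (mean2_translate t cg pg)) _.
  by apply: eq_mean2 => z; rewrite /= tE.
rewrite -(integral_pos_part_powR cNf hp).
have -> : [set x | 0 < - psi x] = [set x | psi x < 0].
  by apply/funext => z /=; rewrite oppr_gt0.
by apply: eq_integral => z _; rewrite normrN.
Qed.
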